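(* Let $X$ and $Y$ be non-negative absolutely continuous random variables with probability density functions $f$ and $g$, let $\omega>0$ be a weight function, $\alpha>0$ and $\beta\ge1$. Let $X_{e,\alpha}$ and $Y_{e,\alpha}$ be the escort random variables of order $\alpha$ with baseline densities $f$ and $g$. Then $$CI_\beta^\omega(X_{e,\alpha},Y_{e,\alpha})=\frac{CI_{\alpha\beta}^\omega(X,Y)}{\sqrt{(I_\alpha(X)I_\alpha(Y))^\beta}}\le\frac{I_{\alpha\beta}^\omega(X)+I_{\alpha\beta}^\omega(Y)}{2\sqrt{(I_\alpha(X)I_\alpha(Y))^\beta}}.$$
   Context: For $X$ with density $f$, a measurable weight $\omega$ and an order $p>0$: $I_p^\omega(X)=\int_0^\infty\omega(u)f^p(u)\,du$ (general weighted information generating function) and $I_p(X)=\int_0^\infty f^p(u)\,du$. The weighted $p$-cross informational energy of $X,Y$ (densities $f,g$) is $CI_p^\omega(X,Y)=\int_0^\infty\omega(x)\sqrt{f^p(x)g^p(x)}\,dx$. The escort random variable $X_{e,\alpha}$ of order $\alpha>0$ has density $f_{e,\alpha}(u)=f^\alpha(u)/\int_0^\infty f^\alpha(v)\,dv$, $u>0$; $Y_{e,\alpha}$ is defined likewise from $g$. All integrals are assumed to exist (be finite). *)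

(* Defs.v *)
From HB Require Import structures.
From mathcomp Require Import all_boot all_order all_algebra.
From mathcomp Require Import all_classical all_reals all_analysis.

Set Implicit Arguments.
Unset Strict Implicit.
Unset Printing Implicit Defensive.

Import Order.TTheory GRing.Theory Num.Theory.
Import numFieldNormedType.Exports.

Local Open Scope classical_set_scope.
Local Open Scope ring_scope.

Definition is_density d (T : measurableType d) (R : realType)
    (P : probability T R) (X : {RV P >-> R}) (f : R -> R) : Prop :=
  [/\ measurable_fun setT f, (forall u, 0 <= f u) &
      forall A : set R, measurable A ->
        distribution P X A =
          (\int[@lebesgue_measure R]_(u in A) (f u)%:E)%E].

(* A density is only determined up to a null set, so the version that is used
   is part of the data: the functionals below are computed from it. *)
Record nonneg_ac_RV d (T : measurableType d) (R : realType)
    (P : probability T R) := NonnegAcRV {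
  ac_rv :> {RV P >-> R} ;
  pdf : R -> R ;
  pdfP : is_density ac_rv pdf ;
  ac_rv_ge0 : {ae P, forall t, 0 <= (ac_rv : T -> R) t} }.

Section information_functionals.
Context (R : realType).
Local Notation mu := (@lebesgue_measure R).
Local Notation pos := (`]0, +oo[%classic : set R).

Section one_variable.
Context d (T : measurableType d) (P : probability T R).
Implicit Types (X : nonneg_ac_RV P) (omega : R -> R) (p : R).

Definition weighted_IG omega p X : R :=
  Rintegral mu pos (fun u => omega u * pdf X u `^ p).

Definition finite_weighted_IG omega p X : Prop :=
  mu.-integrable pos (EFin \o (fun u => omega u * pdf X u `^ p)).

Definition IG p X : R := Rintegral mu pos (fun u => pdf X u `^ p).

Definition finite_IG p X : Prop :=
  mu.-integrable pos (EFin \o (fun u => pdf X u `^ p)).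

Definition escort_pdf alpha X (u : R) : R := pdf X u `^ alpha / IG alpha X.

End one_variable.

Section two_variables.
Context d1 (T1 : measurableType d1) (P1 : probability T1 R).
Context d2 (T2 : measurableType d2) (P2 : probability T2 R).

Definition weighted_CI (omega : R -> R) (p : R)
    (X : nonneg_ac_RV P1) (Y : nonneg_ac_RV P2) : R :=
  Rintegral mu pos
    (fun x => omega x * Num.sqrt (pdf X x `^ p * pdf Y x `^ p)).

Definition finite_weighted_CI (omega : R -> R) (p : R)
    (X : nonneg_ac_RV P1) (Y : nonneg_ac_RV P2) : Prop :=
  mu.-integrable pos
    (EFin \o (fun x => omega x * Num.sqrt (pdf X x `^ p * pdf Y x `^ p))).

(* The escort variable is specified by its density only, so it may live on
   another probability space than the baseline variable. *)
Definition is_escort (alpha : R)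
    (X : nonneg_ac_RV P1) (Xe : nonneg_ac_RV P2) : Prop :=
  forall u, 0 < u -> pdf Xe u = escort_pdf alpha X u.

End two_variables.
End information_functionals.

(* Main.v *)
(* Pointwise on ]0, +oo[ the normalising constants of the escort densities factor
   out of the square root, which gives the equality; the inequality is the
   pointwise AM-GM bound sqrt (f^p g^p) <= (f^p + g^p) / 2, integrated against
   the weight. *)
Require Import Defs.
From mathcomp Require Import all_boot all_order all_algebra.
From mathcomp Require Import all_classical all_reals all_analysis.
Import Order.TTheory GRing.Theory Num.Theory.
Import numFieldNormedType.Exports.
Local Open Scope classical_set_scope.
Local Open Scope ring_scope.

(** Writing [y^-1] as the real power of [y] with exponent -1 turns the claim into multiplication of
    exponents. The case [y = 0] is included, since the inverse of 0 is 0. *)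
Lemma powR_div (R : realType) (x y r : R) :
  0 <= x -> 0 <= y -> (x / y) `^ r = x `^ r / y `^ r.
Proof.
move=> x0 y0; rewrite powRM ?invr_ge0// -(powR_inv1 y0) -powRrM.
by rewrite mulN1r powRN.
Qed.

Lemma sqrtr_AGM (R : rcfType) (x y : R) :
  0 <= x -> 0 <= y -> Num.sqrt (x * y) <= (x + y) / 2.
Proof.
move=> x0 y0; have s0 : 0 <= (x + y) / 2 by rewrite divr_ge0 ?addr_ge0.
(* The mean is nonnegative, hence equals the root of its own square; monotonicity of the root leaves
   [x * y <= ((x + y) / 2) ^+ 2]. *)
by rewrite -(ger0_norm s0) -sqrtr_sqr ler_wsqrtr// (leif_AGM2 x y).
Qed.

(** Used with [x], [y] the values of the two densities at a point and [a], [b] their normalising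
    constants. Only [0 <= a] and [0 <= b] are asked, so [IG_ge0] is enough to apply it. *)
Lemma sqrt_powR_div (R : realType) (x y a b p r : R) :
  0 <= x -> 0 <= y -> 0 <= a -> 0 <= b ->
  Num.sqrt ((x `^ p / a) `^ r * (y `^ p / b) `^ r) =
  Num.sqrt (x `^ (p * r) * y `^ (p * r)) / Num.sqrt ((a * b) `^ r).
Proof.
move=> x0 y0 a0 b0; rewrite !powR_div ?powR_ge0// -!powRrM mulrACA -invfM.
by rewrite -(powRM _ a0 b0) sqrtrM ?mulr_ge0 ?powR_ge0// sqrtrV ?powR_ge0.
Qed.

Lemma pdf_ge0 d (T : measurableType d) (R : realType) (P : probability T R)
  (X : nonneg_ac_RV P) u : 0 <= pdf X u.
Proof. by case: (pdfP X). Qed.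

Lemma IG_ge0 d (T : measurableType d) (R : realType) (P : probability T R)
  (p : R) (X : nonneg_ac_RV P) : 0 <= IG p X.
Proof. by apply: Rintegral_ge0 => u _; exact: powR_ge0. Qed.

Lemma weighted_CI_escort (R : realType)
  (dX dY dXe dYe : measure_display)
  (TX : measurableType dX) (TY : measurableType dY)
  (TXe : measurableType dXe) (TYe : measurableType dYe)
  (PX : probability TX R) (PY : probability TY R)
  (PXe : probability TXe R) (PYe : probability TYe R)
  (X : nonneg_ac_RV PX) (Y : nonneg_ac_RV PY)
  (Xe : nonneg_ac_RV PXe) (Ye : nonneg_ac_RV PYe)
  (omega : R -> R) (alpha beta : R) :
  is_escort alpha X Xe -> is_escort alpha Y Ye ->
  finite_weighted_CI omega (alpha * beta) X Y ->
  weighted_CI omega beta Xe Ye =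
    weighted_CI omega (alpha * beta) X Y /
      Num.sqrt ((IG alpha X * IG alpha Y) `^ beta).
Proof.
move=> XeP YeP finCI; rewrite /weighted_CI -RintegralZr//.
(* [is_escort] fixes the escort densities only at [0 < u], so the integrands are compared on the
   domain of integration. *)
apply: eq_Rintegral => u; rewrite inE/= in_itv/= andbT => u0.
rewrite XeP// YeP// /escort_pdf -mulrA.
by rewrite sqrt_powR_div ?pdf_ge0 ?IG_ge0.
Qed.

Lemma weighted_CI_le (R : realType) (dX dY : measure_display)
  (TX : measurableType dX) (TY : measurableType dY)
  (PX : probability TX R) (PY : probability TY R)
  (X : nonneg_ac_RV PX) (Y : nonneg_ac_RV PY) (omega : R -> R) (p : R) :
  (forall u : R, 0 < u -> 0 <= omega u) ->
  finite_weighted_IG omega p X -> finite_weighted_IG omega p Y ->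
  finite_weighted_CI omega p X Y ->
  weighted_CI omega p X Y <= (weighted_IG omega p X + weighted_IG omega p Y) / 2.
Proof.
move=> omega0 finX finY finCI; rewrite /weighted_CI /weighted_IG -RintegralD//.
rewrite -RintegralZr//; last exact: integrableD finX finY.
apply: le_Rintegral => //.
  exact: integrableZr (integrableD _ finX finY).
move=> u; rewrite /= in_itv/= andbT => u0.
(* The weight is factored out of the sum; being nonnegative at [u], it preserves the AM-GM bound. *)
by rewrite -mulrDr -mulrA ler_wpM2l ?omega0// sqrtr_AGM ?powR_ge0.
Qed.

Theorem proposition4p2 (R : realType)
  (dX dY dXe dYe : measure_display)
  (TX : measurableType dX) (TY : measurableType dY)
  (TXe : measurableType dXe) (TYe : measurableType dYe)
  (PX : probability TX R) (PY : probability TY R)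
  (PXe : probability TXe R) (PYe : probability TYe R)
  (X : nonneg_ac_RV PX) (Y : nonneg_ac_RV PY)
  (Xe : nonneg_ac_RV PXe) (Ye : nonneg_ac_RV PYe)
  (omega : R -> R) (alpha beta : R)
  (omega_meas : measurable_fun (`]0, +oo[ : set R) omega)
  (omega_gt0 : forall u : R, 0 < u -> 0 < omega u)
  (alpha_gt0 : 0 < alpha) (beta_ge1 : 1 <= beta)
  (XeP : is_escort alpha X Xe) (YeP : is_escort alpha Y Ye)
  (finIX : finite_IG alpha X) (finIY : finite_IG alpha Y)
  (finIwX : finite_weighted_IG omega (alpha * beta) X)
  (finIwY : finite_weighted_IG omega (alpha * beta) Y)
  (finCI : finite_weighted_CI omega (alpha * beta) X Y)
  (finCIe : finite_weighted_CI omega beta Xe Ye) :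
  weighted_CI omega beta Xe Ye =
    weighted_CI omega (alpha * beta) X Y /
      Num.sqrt ((IG alpha X * IG alpha Y) `^ beta)
  /\
  weighted_CI omega (alpha * beta) X Y /
      Num.sqrt ((IG alpha X * IG alpha Y) `^ beta)
    <= (weighted_IG omega (alpha * beta) X + weighted_IG omega (alpha * beta) Y)
         / (2 * Num.sqrt ((IG alpha X * IG alpha Y) `^ beta)).
Proof.
split; first exact: weighted_CI_escort.
(* Splitting the inverse of the product makes the root a common factor of both sides; its inverse is
   nonnegative, even when the root is 0. *)
rewrite invfM mulrA ler_wpM2r ?invr_ge0 ?sqrtr_ge0//.
by apply: weighted_CI_le => // u /omega_gt0/ltW.
Qed.
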